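(* Let $G$ be a finite group such that $\gamma(G)=1$. Then $G\in\mathcal{C}$ if and only if $G\cong S_3$.
   Context: For a finite group $G$, $L(G)$ denotes the set (lattice) of all subgroups of $G$, and $\gamma(G)$ denotes the number of conjugacy classes of non-normal subgroups of $G$. For $H\in L(G)$, the relative subgroup commutativity degree of $H$ in $G$ is $$sd(H,G)=\frac{1}{|L(H)||L(G)|}\left|\{(H_1,G_1)\in L(H)\times L(G) \mid H_1G_1=G_1H_1\}\right|.$$ Let $f:L(G)\to[0,1]$, $f(H)=sd(H,G)$. The class $\mathcal{C}$ consists of all finite groups $G$ for which $|\mathrm{Im}\, f|=2$, i.e. for which $f$ takes exactly two distinct values. $S_3$ is the symmetric group on three letters. *)

(* Defs.v *)
(* MathComp *)
From mathcomp Require Import all_boot all_order all_algebra all_fingroup.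

Set Implicit Arguments.
Unset Strict Implicit.
Unset Printing Implicit Defensive.

Section RelativeSubgroupCommutativity.

Variable gT : finGroupType.

(* Conjugacy classes of subgroups are orbits of G acting on {group gT} by
   conjugation. *)
Definition nonnormal_classes (G : {group gT}) : {set {set {group gT}}} :=
  [set orbit 'JG%act G H | H in subgroups G & ~~ (H <| G)%g].

Definition gamma (G : {group gT}) : nat := #|nonnormal_classes G|.

Definition permuting_pairs (H G : {group gT}) :
    {set {group gT} * {group gT}} :=
  [set p in setX (subgroups H) (subgroups G) |
    (p.1 * p.2 == p.2 * p.1 :> {set gT})%g].

Definition sd (H G : {group gT}) : rat :=
  (#|permuting_pairs H G|%:R / (#|subgroups H| * #|subgroups G|)%:R)%R.

(* The image of H |-> sd H G on L(G), as a duplicate-free sequence. *)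
Definition sd_image (G : {group gT}) : seq rat :=
  undup [seq sd H G | H : {group gT} in subgroups G].

Definition classC (G : {group gT}) : Prop := size (sd_image G) = 2.

End RelativeSubgroupCommutativity.

(* Main.v *)
(* Fix a non-normal subgroup H; every other non-normal subgroup is one of its
   k conjugates, so sd(K, G) = 1 - D(K) / (|L(K)| |L(G)|), where D(K) = 0 for K
   normal without H, D(K) = k d for K normal containing H, and D(H^x) = d, with
   d the number of subgroups not permuting with H.  Hence G is in C iff d > 0,
   |L(G)| = k |L(H)| and G is the only normal subgroup containing H.  Then H is
   maximal and self-normalizing, its proper subgroups are normal, and it has a
   normal complement P of prime order.  A normal subgroup of G is either a
   proper subgroup of H or of the form P M with M <= H, so that
   k |L(H)| = |L(G)| <= k + 2 |L(H)| - 1.  As k >= 3, this forces k = 3 and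
   |L(H)| = 2, and G acts faithfully on the three conjugates of H. *)
Require Import Defs.
From mathcomp Require Import all_boot all_order all_algebra all_fingroup.
From mathcomp Require Import all_solvable.
From mathcomp Require Import zify.

(** The value [x] serves as a base point. Below it is the degree of the trivial subgroup, so that
    the values other than [x] come from the subgroups of nonzero defect. *)
Lemma size_undup2P {T : eqType} {x : T} {s : seq T} : x \in s ->
  size (undup s) = 2 <->
  (exists2 y, y \in s & y != x) /\
  {in s &, forall y z, y != x -> z != x -> y = z}.
Proof.
move=> xs; split=> [s2 | [[y ys yx] sE]].
  split=> [|y z ys zs yx zx].
    apply/hasP; apply: contraT => /hasPn sx.
    suff: size (undup s) <= size [:: x] by rewrite s2.
    apply: uniq_leq_size (undup_uniq s) _ => y.
    by rewrite mem_undup inE => /sx; rewrite negbK.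
  apply/eqP; apply: contraT => yz.
  suff: size [:: x; y; z] <= size (undup s) by rewrite s2.
  apply: uniq_leq_size => [|t].
    by rewrite /= !inE negb_or !(eq_sym x) yx zx yz.
  by rewrite mem_undup !inE => /or3P[]/eqP->.
have /perm_size -> // : perm_eq (undup s) [:: x; y].
apply: uniq_perm => [|/=|z]; rewrite ?undup_uniq ?inE ?(eq_sym x) ?yx //.
rewrite mem_undup; apply/idP/orP => [zs | [/eqP->|/eqP->] //].
by case: (eqVneq z x) => zx; [left | right; rewrite (sE z y)].
Qed.

(** * Counting non-permuting pairs *)

Section Defect.

Set Implicit Arguments.
Unset Strict Implicit.

Local Open Scope group_scope.

Variables (gT : finGroupType) (G : {group gT}).
Implicit Types A B H K : {group gT}.

Definition nonpermuting A : {set {group gT}} :=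
  [set B in subgroups G | A * B != B * A].

(** The numerator of 1 - sd(A, G) over |L(A)| |L(G)|, written D(A) in the overview. It moves
    comparisons of degrees from rationals to natural numbers. *)
Definition defect A : nat := (\sum_(B in subgroups A) #|nonpermuting B|)%N.

Lemma subgroups_gt0 A : (0 < #|subgroups A|)%N.
Proof. by apply/card_gt0P; exists A; rewrite inE subxx. Qed.

Lemma card_permuting_pairs A :
  (#|permuting_pairs A G| + defect A = #|subgroups A| * #|subgroups G|)%N.
Proof.
rewrite -sum_nat_const -sum1_card.
have -> : (\sum_(p in permuting_pairs A G) 1)%N =
  (\sum_(B in subgroups A) #|[set C in subgroups G | (B * C == C * B)%g]|)%N.
  under [RHS]eq_bigr do rewrite -sum1_card.
  rewrite pair_big_dep; apply: eq_bigl => -[B C].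
  by rewrite !inE /= -andbA.
rewrite -big_split; apply: eq_bigr => B _ /=.
rewrite -(cardsID [set C : {group gT} | B * C == C * B] (subgroups G)).
by congr (_ + _)%N; apply: eq_card => C; rewrite !inE // andbC.
Qed.

(** In 1 - sd the factor |L(G)| is common to both sides and cancels. *)
Lemma sd_eq A B : (sd A G == sd B G) =
  (defect A * #|subgroups B| == defect B * #|subgroups A|)%N.
Proof.
have [a0 b0 g0] := And3 (subgroups_gt0 A) (subgroups_gt0 B) (subgroups_gt0 G).
have [eA eB] := (card_permuting_pairs A, card_permuting_pairs B).
rewrite /sd GRing.eqr_div ?Num.Theory.pnatr_eq0 -?lt0n ?muln_gt0 ?a0 ?b0 //.
rewrite -!GRing.natrM Num.Theory.eqr_nat.
move: a0 b0 g0 eA eB; move: #|subgroups A| #|subgroups B| #|subgroups G|.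
move: (defect A) (defect B) #|_| #|_| => da db pa pb a b g a0 b0 g0 eA eB.
apply/eqP/eqP => E; nia.
Qed.

Lemma nonpermuting_normal A : A <| G -> nonpermuting A = set0.
Proof.
case/andP=> _ nAG; apply/setP=> B; rewrite !inE; apply/negbTE/nandP.
case sBG: (B \subset G); [right | by left].
by rewrite negbK (normC (subset_trans sBG nAG)).
Qed.

Lemma card_nonpermutingJ A x : x \in G ->
  #|nonpermuting (A :^ x)| = #|nonpermuting A|.
Proof.
move=> Gx; rewrite -[RHS](card_imset _ (act_inj 'JG x)).
apply: eq_card => B; apply/idP/imsetP => [|[C CP ->]].
  rewrite !inE => /andP[sBG nc]; exists (B :^ x^-1)%G; last first.
    by apply/val_inj; rewrite /= conjsgKV.
  rewrite !inE /= -(conjGid (groupVr Gx)) conjSg sBG /=.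
  apply: contra nc => /eqP /(congr1 (conjugate^~ x)).
  by rewrite !conjsMg conjsgKV => ->.
move: CP; rewrite !inE /= -{2}(conjGid Gx) conjSg -!conjsMg => /andP[-> nc].
by apply: contra nc => /eqP/conjsg_inj->.
Qed.

End Defect.

(** * Defects when all non-normal subgroups are conjugate *)

Section OneClass.

Set Implicit Arguments.
Unset Strict Implicit.

Local Open Scope group_scope.

Variables (gT : finGroupType) (G H : {group gT}).
Implicit Types A B K : {group gT}.

Let conjs := orbit 'JG%act G H.

Hypotheses (sHG : H \subset G) (nnH : ~~ (H <| G)).
Hypothesis oneH : forall K, K \subset G -> ~~ (K <| G) -> K \in conjs.

Lemma in_conjsP K :
  reflect (exists2 x, x \in G & K = (H :^ x)%G) (K \in conjs).
Proof.
by apply: (iffP orbitP) => -[x Gx eK]; exists x.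
Qed.

Lemma card_in_conjs K : K \in conjs -> #|K| = #|H|.
Proof. by case/in_conjsP=> x _ ->; rewrite cardJg. Qed.

Lemma conjs_sub K : K \in conjs -> K \subset G.
Proof. by case/in_conjsP=> x Gx ->; rewrite conj_subG. Qed.

Lemma conjs_nnormal K : K \in conjs -> ~~ (K <| G).
Proof.
case/in_conjsP=> x Gx ->; apply: contra nnH => nK.
by rewrite -(normalJ _ _ x) (conjGid Gx).
Qed.

(** Conjugates share their order, so an order different from that of [H] certifies normality. *)
Lemma normal_neq_card K : K \subset G -> #|K| != #|H| -> K <| G.
Proof.
by move=> sKG; apply: contraR => /(oneH sKG)/card_in_conjs->.
Qed.

Lemma normal_proper K : K \proper H -> K <| G.
Proof.
move=> pKH; rewrite normal_neq_card ?(subset_trans (proper_sub pKH)) //.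
by rewrite neq_ltn proper_card.
Qed.

(** By normality [A] contains every conjugate of [H]; these contribute equally, and all other
    subgroups of [A] are normal in [G] and contribute nothing. *)
Lemma defect_normal_sup A : A <| G -> H \subset A ->
  defect G A = (#|conjs| * #|nonpermuting G H|)%N.
Proof.
move=> nAG sHA; rewrite -sum_nat_const /defect.
rewrite (big_setID conjs) /= [X in (_ + X)%N]big1 ?addn0 => [|B]; last first.
  rewrite !inE => /andP[cB sBA].
  rewrite nonpermuting_normal ?cards0 //; apply: contraR cB.
  exact/oneH/(subset_trans sBA)/normal_sub.
apply: congr_big => // [B|B].
  rewrite !inE andb_idl // => /in_conjsP[x Gx ->].
  by rewrite -(normP (subsetP (normal_norm nAG) x Gx)) conjSg.
by rewrite inE => /andP[_ /in_conjsP[x Gx ->]]; rewrite card_nonpermutingJ.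
Qed.

Lemma defect_normal_nsup A : A <| G -> ~~ (H \subset A) -> defect G A = 0%N.
Proof.
move=> nAG nsHA; rewrite /defect big1 // => B; rewrite inE => sBA.
rewrite nonpermuting_normal ?cards0 //; apply: contraR nsHA => nnB.
have /in_conjsP[x Gx eB] := oneH (subset_trans sBA (normal_sub nAG)) nnB.
by rewrite -(conjSg _ _ x) (normP (subsetP (normal_norm nAG) x Gx));
  move: sBA; rewrite eB.
Qed.

(** Proper subgroups of [A] are too small to be conjugate to [H], so they are normal and only the
    term of [A] itself survives. *)
Lemma defect_conjs A : A \in conjs -> defect G A = #|nonpermuting G H|.
Proof.
move=> cA; rewrite /defect (big_setD1 A) ?inE //= big1 => [|B]; last first.
  rewrite !inE => /andP[nBA sBA]; rewrite nonpermuting_normal ?cards0 //.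
  rewrite normal_neq_card ?(subset_trans sBA) ?conjs_sub //.
  rewrite -(card_in_conjs cA) neq_ltn proper_card //.
  by rewrite properEneq sBA andbT.
by case/in_conjsP: cA => x Gx ->; rewrite addn0 card_nonpermutingJ.
Qed.

Lemma card_subgroups_conjs A : A \in conjs -> #|subgroups A| = #|subgroups H|.
Proof.
case/in_conjsP=> x Gx ->; rewrite -[RHS](card_imset _ (act_inj 'JG x)).
apply: eq_card => B; apply/idP/imsetP => [|[C + ->]]; rewrite !inE.
  exists (B :^ x^-1)%G; last by apply/val_inj; rewrite /= conjsgKV.
  by rewrite inE /= sub_conjgV.
by rewrite /= conjSg.
Qed.

Lemma classC_iff : classC G <->
  [/\ 0 < #|nonpermuting G H|,
      #|subgroups G| = #|conjs| * #|subgroups H| &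
      forall K, K <| G -> H \subset K -> K :=: G]%N.
Proof.
have L1 := subgroups_gt0 [1 gT]; have LH := subgroups_gt0 H.
have LG := subgroups_gt0 G.
have c0 : (0 < #|conjs|)%N by apply/card_gt0P; exists H; apply: orbit_refl.
have cH : H \in conjs by apply: orbit_refl.
have sd_im A : A \subset G ->
    sd A G \in [seq sd B G | B : {group gT} in subgroups G].
  by move=> sAG; apply: (image_f (fun B : {group gT} => sd B G)); rewrite inE.
have nsH1 : ~~ (H \subset [1 gT]).
  by apply: contra nnH => /trivgP->; apply: normal1.
(* The trivial subgroup has defect 0, so a degree differs from the base value exactly when the
   defect is positive. *)
have sdE A : (sd A G != sd [1 gT] G) = (0 < defect G A)%N.
  rewrite sd_eq (defect_normal_nsup (normal1 G) nsH1) mul0n muln_eq0 lt0n.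
  by rewrite -[#|subgroups 1%G| == 0]negbK -lt0n L1 orbF.
rewrite /classC /sd_image (size_undup2P (sd_im _ (sub1G G)));
  split=> [[neq1 allE] | [d0 LE maxH]].
  have d0 : (0 < #|nonpermuting G H|)%N.
    case: neq1 => _ /imageP[A /[!inE] sAG ->]; rewrite sdE.
    case nA: (A <| G).
      case sHA: (H \subset A); last by rewrite defect_normal_nsup ?sHA.
      by rewrite defect_normal_sup // muln_gt0 => /andP[].
    by rewrite defect_conjs // oneH // nA.
  have allE' A B : A \subset G -> B \subset G -> (0 < defect G A)%N ->
      (0 < defect G B)%N -> sd A G == sd B G.
    by move=> sA sB dA dB; apply/eqP/allE; rewrite ?sdE ?sd_im.
  have dG := defect_normal_sup (normal_refl G) sHG.
  have dH := defect_conjs cH.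
  have dG0 : (0 < defect G G)%N by rewrite dG muln_gt0 c0.
  split=> // [|K nK sHK].
    (* With d the number of subgroups not permuting with [H], equal degrees of [H] and [G] read d
       |L(G)| = k d |L(H)|, and d > 0 cancels. *)
    have := allE' H G sHG (subxx _); rewrite dH => /(_ d0 dG0).
    by rewrite sd_eq dG dH -mulnA mulnCA eqn_pmul2l // => /eqP.
  have dK := defect_normal_sup nK sHK.
  (* [K] and [G] have the same positive defect, so equal degrees force |L(K)| = |L(G)| and [G] is
     itself a subgroup of [K]. *)
  have := allE' K G (normal_sub nK) (subxx _).
  rewrite sd_eq dK -dG => /(_ dG0 dG0); rewrite eqn_pmul2l // => /eqP E.
  have sub : subgroups K \subset subgroups G.
    by apply/subsetP=> B; rewrite !inE => /subset_trans->; rewrite ?normal_sub.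
  have /eqP/setP/(_ G) : subgroups K == subgroups G by rewrite eqEcard sub E
    leqnn.
  by rewrite !inE subxx => sGK; apply/eqP;
    rewrite eqEsubset sGK (normal_sub nK).
(* A subgroup of positive defect is [G] or a conjugate of [H]; the count of L(G) gives both the
   degree of [H]. *)
have cmp A : A \subset G -> sd A G != sd [1 gT] G -> sd A G == sd H G.
  move=> sAG; rewrite sdE; case nA: (A <| G).
    case sHA: (H \subset A); last by rewrite defect_normal_nsup ?sHA.
    move=> _; rewrite sd_eq defect_normal_sup // defect_conjs //.
    by have /group_inj-> := maxH A nA sHA; rewrite LE mulnAC mulnC.
  have cA : A \in conjs by rewrite oneH // nA.
  by rewrite sd_eq !defect_conjs // card_subgroups_conjs.
split=> [|_ _ /imageP[A + ->] /imageP[B + ->]]; last first.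
  by rewrite !inE => sA sB nA nB;
    rewrite (eqP (cmp A sA nA)) (eqP (cmp B sB nB)).
exists (sd H G); first exact: sd_im.
by rewrite sdE defect_conjs.
Qed.

Lemma card_subgroups :
  #|subgroups G| = (#|conjs| + #|[set K in subgroups G | K <| G]|)%N.
Proof.
rewrite -(cardsID conjs (subgroups G)); congr (_ + _)%N; apply: eq_card => K.
  by rewrite !inE andb_idl // => /conjs_sub.
rewrite !inE andbC; case sKG: (K \subset G) => //=.
apply/idP/idP => [|nK]; first by apply: contraR => /(oneH sKG).
by apply: contraL nK; apply: conjs_nnormal.
Qed.

(** * Structure of the group when only the whole group is normal above [H] *)

Hypothesis maxH : forall K, K <| G -> H \subset K -> K :=: G.

(** A strictly larger [K] has another order than [H], hence is normal, and [maxH] applies. *)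
Lemma eq_overgroup K : H \subset K -> K \subset G -> K :=: H \/ K :=: G.
Proof.
move=> sHK sKG; have [eKH|nKH] := eqVneq #|K| #|H|.
  by left; apply/eqP; rewrite eq_sym eqEcard sHK eKH /=.
by right; rewrite (maxH (normal_neq_card sKG nKH)).
Qed.

Lemma normG_self : 'N_G(H) = H.
Proof.
have sHN : H \subset 'N_G(H) by rewrite subsetI sHG normG.
case: (eq_overgroup sHN (subsetIl _ _)) => //= eN.
by case/negP: nnH; rewrite /normal sHG -{1}eN subsetIr.
Qed.

Lemma card_conjs : #|conjs| = #|G : H|.
Proof. by rewrite card_orbit astab1JG normG_self. Qed.

Lemma index_gt2 : (2 < #|G : H|)%N.
Proof.
have := indexg_gt0 G H; case E: #|G : H| => [|[|[|n]]] // _; case/negP: nnH.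
  move/eqP: E; rewrite indexg_eq1 => sGH.
  have /group_inj-> : H :=: G by apply/eqP; rewrite eqEsubset sHG.
  exact: normal_refl.
exact: index2_normal.
Qed.

Lemma sub_gcore_proper K : K \proper H -> K \subset gcore H G.
Proof.
by move=> pK; apply/gcore_max/normal_norm/normal_proper; rewrite ?proper_sub.
Qed.

(* An element of H outside the core generates H, so H is cyclic with a unique
   maximal subgroup. *)
Lemma pgroup_or_p'group p : p.-group H || p^'.-group H.
Proof.
have : gcore H G \proper H.
  rewrite properEneq gcore_sub andbT; apply: contra nnH => /eqP eC.
  by rewrite -eC gcore_normal.
case/properP=> _ [x Hx]; apply: contraR; rewrite negb_or => /andP[npH np'H].
(* If [H] is not a pi-group, the pi-part of [x] cannot generate it, so it generates a proper
   subgroup and lies in the core. Were this so for both p and p', their product [x] would lie in the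
   core too. *)
have constt_core (pi : nat_pred) : ~~ pi.-group H -> x.`_pi \in gcore H G.
  move=> npi; apply: (subsetP (sub_gcore_proper (K := <[x.`_pi]>) _));
    rewrite ?cycle_id //.
  rewrite properEneq cycle_subG groupX // andbT.
  by apply: contra npi => /eqP <-; apply: p_elt_constt.
by rewrite -(consttC p x) groupM ?constt_core.
Qed.

(** Once p is known not to divide |H|, a subgroup of order p given by Cauchy is normal because of
    its order, meets [H] trivially, and generates [G] with [H] by maximality. *)
Lemma normal_complement_prime p : prime p -> p %| #|G : H| ->
  exists2 P : {group gT}, P <| G &
    [/\ #|P| = p, P * H = G & coprime p #|H|].
Proof.
move=> p_pr pidx.
have p'H : p^'.-group H.
  (* A p-group [H] would be proper in a Sylow subgroup, as p divides the index; normalizers grow in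
     nilpotent groups, but [H] is self-normalizing. *)
  have /orP[pH|//] := pgroup_or_p'group p.
  have [S sylS sHS] := Sylow_superset sHG pH.
  have pHS : H \proper S.
    rewrite properEneq sHS andbT; apply: contraL pidx => /eqP eHS.
    by move: sylS; rewrite -eHS => /and3P[_ _]; rewrite p'natE.
  have := nilpotent_proper_norm (pgroup_nil (pHall_pgroup sylS)) pHS.
  rewrite properE => /andP[_]; rewrite -{2}normG_self.
  by rewrite setSI ?(pHall_sub sylS).
have copH : coprime p #|H| by rewrite prime_coprime // -p'natE.
have pG : p %| #|G| by rewrite -(Lagrange sHG) dvdn_mull.
have [y Gy oy] := Cauchy p_pr pG.
have sPG : <[y]> \subset G by rewrite cycle_subG.
have nP : <[y]> <| G.
  apply: normal_neq_card => //; rewrite -orderE oy;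
    apply: contraL copH => /eqP <-.
  by rewrite /coprime gcdnn neq_ltn prime_gt1 ?orbT.
have tiPH : <[y]> :&: H = 1 by rewrite coprime_TIg // -orderE oy.
exists <[y]>%G => //; split=> //.
have nPH := subset_trans sHG (normal_norm nP).
rewrite -(norm_joinEr nPH).
case: (@eq_overgroup (<[y]> <*> H)) => //;
  rewrite ?joing_subr ?join_subG ?sPG //=.
move=> eJ; have sPH : <[y]> \subset H by rewrite -eJ joing_subl.
have := prime_gt1 p_pr; rewrite -oy orderE -(setIidPl sPH) tiPH cards1.
by rewrite ltnn.
Qed.

(* All normal subgroups K outside H contain the complement P, so that
   K = P (K :&: H) is determined by K :&: H. *)
Lemma card_normal_le :
  #|[set K in subgroups G | K <| G]| < #|subgroups H|.*2.
Proof.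
set N := [set K in _ | _]; pose p := pdiv #|G : H|.
have idx1 : 1 < #|G : H| by apply: ltnW index_gt2.
have p_pr : prime p := pdiv_prime idx1.
have [P nP [oP PH copH]] := normal_complement_prime p_pr (pdiv_dvd _).
have p'H : ~~ (p %| #|H|) by rewrite -prime_coprime.
have sPK K : K <| G -> ~~ (K \subset H) -> P \subset K.
  move=> nK nsKH; have nKH := subset_trans sHG (normal_norm nK).
  have KH : K * H = G.
    rewrite -norm_joinEr //.
    case: (@eq_overgroup (K <*> H)%G) => //;
      rewrite ?joing_subr ?join_subG ?(normal_sub nK) ?sHG //=.
    by move=> eJ; case/negP: nsKH; rewrite -eJ joing_subl.
  apply: contraR p'H => nsPK.
  have tiPK : P :&: K = 1 by rewrite prime_TIg ?oP.
  (* If [K] misses [P], then |K| divides |G| / p = |H|; but [K * H = G] makes p divide |K| |H|,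
     hence |H|. *)
  have oG : #|G| = (#|P| * #|H|)%N by rewrite -PH coprime_cardMg // oP.
  have dKH : #|K| %| #|H|.
    rewrite -(dvdn_pmul2l (cardG_gt0 P)) -oG -TI_cardMg //.
    rewrite -norm_joinEr ?(subset_trans (normal_sub nK) (normal_norm nP)) //.
    by rewrite cardSg // join_subG !normal_sub.
  have : p %| #|K| * #|H| by rewrite mul_cardG KH oG oP -!mulnA dvdn_mulr.
  by rewrite Euclid_dvdM // => /orP[/dvdn_trans->|].
(* Normal subgroups inside [H] number fewer than |L(H)|, since [H] itself is excluded; those outside
   embed into L(H) by intersection with [H]. *)
rewrite -(cardsID [set K : {group gT} | K \subset H] N) -addnn -addSn.
apply: leq_add.
  rewrite (cardsD1 H (subgroups H)) inE subxx ltnS.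
  apply/subset_leq_card/subsetP=> K; rewrite !inE => /andP[/andP[_ nK] ->].
  by rewrite andbT; apply: contraNneq nnH => <-.
pose cap K := (K :&: H)%G.
rewrite -(card_in_imset (f := cap)) => [|K L].
  apply/subset_leq_card/subsetP=> _ /imsetP[K _ ->].
  by rewrite inE subsetIr.
rewrite !inE => /andP[nsK /andP[sKG nK]] /andP[nsL /andP[sLG nL]] eKL.
(* Dedekind's modular law recovers [A] from its intersection with [H]. *)
have capE A : A <| G -> ~~ (A \subset H) -> P * (A :&: H) = A.
  move=> nA nsA; rewrite setIC group_modl ?sPK // PH.
  exact/setIidPr/normal_sub.
by apply: group_inj; rewrite -(capE K) // -(capE L) //; congr (P * gval _).
Qed.

Lemma card_conjs_subgroups :
  #|subgroups G| = (#|conjs| * #|subgroups H|)%N ->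
  #|conjs| = 3 /\ #|subgroups H| = 2.
Proof.
have := card_normal_le; rewrite card_subgroups; have := index_gt2;
  rewrite -card_conjs.
have : (1 < #|subgroups H|)%N.
  rewrite (cardsD1 H) inE subxx ltnS; apply/card_gt0P; exists 1%G.
  rewrite !inE sub1G andbT; apply: contraNneq nnH => <-; exact: normal1.
move: #|conjs| #|[set K in _ | _]| #|subgroups H| => k N h h1 k2 ltN eN.
(* From k h = k + N and N < 2 h follows (k - 2)(h - 1) <= 1, where both factors are positive. *)
suff /andP[/eqP k3 /eqP h2] : (k == 3) && (h == 2) by lia.
by apply/andP; split; nia.
Qed.

End OneClass.

(** * Faithful actions with image the full symmetric group *)

Section Faithful.

Set Implicit Arguments.
Unset Strict Implicit.

Local Open Scope group_scope.

Variables (aT : finGroupType) (G : {group aT}) (T : finType).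
Variables (to : {action aT &-> T}) (S : {set T}).

(** Numbering [S] turns the action into an injective morphism to the symmetric group, which is onto
    by the bound on |G|. The point [s0] is the default that [enum_rank_in] requires. *)
Lemma faithful_isog_Sn n s0 : s0 \in S -> #|S| = n -> [acts G, on S | to] ->
  'C_G(S | to) = 1 -> (n`! <= #|G|)%N -> G \isog [set: 'S_n].
Proof.
move=> Ss0 <- actS faith leG.
pose img (x : [subg G]) (i : 'I_#|S|) :=
  enum_rank_in Ss0 (to (enum_val i) (sgval x)).
have imgS (x : [subg G]) (i : 'I_#|S|) : to (enum_val i) (sgval x) \in S.
  by rewrite (acts_act actS) ?enum_valP ?subgP.
have imgE x i : enum_val (img x i) = to (enum_val i) (sgval x).
  by rewrite enum_rankK_in.
have img_inj x : injective (img x).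
  by move=> i j /(congr1 enum_val); rewrite !imgE => /act_inj/enum_val_inj.
pose f x := perm (@img_inj x).
have fM : {in [set: [subg G]] &, {morph f : x y / x * y}}.
  move=> x y _ _; apply/permP=> i; rewrite permM !permE.
  by apply: enum_val_inj; rewrite !imgE actM.
pose fm := Morphism fM.
have fI : 'injm fm.
  apply/subsetP=> x /morphpreP[_ /set1P fx1]; apply/set1P/val_inj.
  suff: sgval x \in 'C_G(S | to) by rewrite faith => /set1P.
  rewrite inE subgP; apply/astabP=> s Ss.
  have := imgE x (enum_rank_in Ss0 s); rewrite enum_rankK_in // => <-.
  move/permP/(_ (enum_rank_in Ss0 s)): fx1; rewrite !permE => ->.
  by rewrite enum_rankK_in.
apply: isog_trans (isog_subg G) _; apply/isogP; exists fm => //.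
apply/eqP; rewrite eqEcard subsetT /= card_injm // -(card_isog (isog_subg G)).
by rewrite cardsT (leq_trans _ leG) // (card_Sn #|S|).
Qed.

End Faithful.

(** * The two implications for a single class *)

Section OneClass.

Set Implicit Arguments.
Unset Strict Implicit.

Local Open Scope group_scope.

Variables (gT : finGroupType) (G H : {group gT}).
Let conjs := orbit 'JG%act G H.
Hypotheses (sHG : H \subset G) (nnH : ~~ (H <| G)).
Hypothesis oneH : forall K : {group gT}, K \subset G -> ~~ (K <| G) ->
  K \in conjs.

Lemma nnormal_gt1 : 1 < #|H|.
Proof.
rewrite cardG_gt1; apply: contraNneq nnH => H1.
by have /group_inj-> : H :=: [1 gT]%G := H1; apply: normal1.
Qed.

Lemma classC_isog_S3 : classC G -> G \isog [set: 'S_3].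
Proof.
move=> /(classC_iff sHG nnH oneH)[_ LE maxH].
have [k3 h2] := card_conjs_subgroups sHG nnH oneH maxH LE.
have idx3 : #|G : H| = 3 by rewrite -(card_conjs sHG nnH oneH maxH).
have H_in : H \in conjs by apply: orbit_refl.
have H1 : [1 gT]%G != H.
  by apply: contraTneq nnormal_gt1 => <-; rewrite cards1.
have subH : [set [1 gT]%G; H] = subgroups H.
  apply/eqP; rewrite eqEcard h2 cards2 H1 andbT.
  by apply/subsetP=> K /set2P[]->; rewrite inE ?sub1G ?subxx.
have actS : [acts G, on conjs | 'JG] by apply: acts_orbit; apply: subsetT.
apply: (faithful_isog_Sn H_in k3 actS); last first.
  by rewrite -(Lagrange sHG) idx3 (leq_mul nnormal_gt1 (leqnn 3)).
(* The kernel of the action on the conjugates lies in the normalizer of [H], which is [H]. It is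
   therefore 1 or [H], and being normal it is not [H]. *)
have : [group of 'C_G(conjs | 'JG)] \in subgroups H.
  have sCN : 'C_G(conjs | 'JG) \subset 'N_G(H).
    by rewrite setIS // -astab1JG astabS // sub1set.
  by rewrite inE (subset_trans sCN) // (normG_self sHG nnH oneH maxH).
rewrite -subH => /set2P[/(congr1 val)//|eC]; case/negP: nnH.
rewrite -eC /normal subsetIl normsI ?normG //.
exact: subset_trans actS (astab_norm _ _).
Qed.

Lemma card6_classC : #|G| = 6 -> classC G.
Proof.
move=> oG; have H1 := nnormal_gt1; have idx := index_gt2 sHG nnH.
have [oH idx3] : #|H| = 2 /\ #|G : H| = 3.
  move: (Lagrange sHG) H1 idx; rewrite oG.
  by move: #|H| #|G : H| => h k; nia.
have maxH (K : {group gT}) : K <| G -> H \subset K -> K :=: G.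
  move=> nK sHK; have sKG := normal_sub nK; apply/eqP; rewrite eqEsubset sKG.
  have dGK : #|G : K| %| 3 by rewrite -idx3 -(Lagrange_index sKG sHK) dvdn_mulr.
  have /primeP[_ /(_ _ dGK)] : prime 3 by [].
  case/orP=> [|/eqP iK]; first by rewrite indexg_eq1.
  case/negP: nnH; have /group_inj-> // : H :=: K.
  apply/eqP; rewrite eqEcard sHK oH.
  by have := Lagrange sKG; rewrite iK oG; case: #|K| => [|[|[|k]]] //; lia.
have cmax := eq_overgroup oneH maxH.
have k3 : #|conjs| = 3 by rewrite (card_conjs sHG nnH oneH maxH).
have neq1H : [1 gT]%G != H by apply: contraTneq H1 => <-; rewrite cards1.
have h2 : #|subgroups H| = 2.
  suff -> : subgroups H = [set [1 gT]%G; H] by rewrite cards2 neq1H.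
  apply/setP=> K; rewrite !inE; apply/idP/orP=> [sKH|[]/eqP->];
    rewrite ?sub1G //.
  have /primeP[_ /(_ _ (cardSg sKH))] : prime #|H| by rewrite oH.
  case/orP=> [cK|/eqP cK]; [left | right].
    by apply/eqP/group_inj/eqP; rewrite trivg_card1.
  by apply/eqP/group_inj/eqP; rewrite eqEcard sKH cK leqnn.
have [y Gy oy] : {y | y \in G & #[y] = 3} by apply: Cauchy; rewrite ?oG.
have nY : <[y]> <| G.
  by apply: (normal_neq_card oneH); rewrite ?cycle_subG // -orderE oy oH.
apply/(classC_iff sHG nnH oneH); split=> //.
  (* The witness is a conjugate of [H] other than [H]: if the two permuted, their product would be a
     group strictly above [H], hence [G], but two subgroups of order 2 cannot have a product of
     order 6. *)
  have [x Gx nx] : exists2 x, x \in G & x \notin 'N(H).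
    by apply/subsetPn; move: nnH; rewrite /normal sHG.
  apply/card_gt0P; exists (H :^ x)%G; rewrite inE inE /= conj_subG //=.
  apply/negP=> /eqP /comm_joingE eJ.
  case: (cmax (H <*> H :^ x)%G);
    rewrite ?joing_subl ?join_subG ?sHG ?conj_subG //=.
    move=> eH; case/negP: nx; rewrite inE.
    by rewrite -{2}eH joing_subr.
  move=> eG; have := mul_cardG H (H :^ x); rewrite -eJ eG cardJg oH oG.
  by move: #|_| => c; lia.
rewrite (card_subgroups sHG nnH oneH) k3 h2; congr (_ + _)%N.
(* It remains to find exactly three normal subgroups: the general bound gives fewer than four, and
   1, the subgroup of order 3 and [G] are three. *)
apply/eqP; rewrite eqn_leq -ltnS.
have := card_normal_le sHG nnH oneH maxH; rewrite h2 => -> /=.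
have <- : #|[set [1 gT]%G; <[y]>%G; G]| = 3.
  rewrite -setUA cardsU1 cards2 !inE negb_or.
  have nc (A B : {group gT}) : #|A| <> #|B| -> A != B.
    by move=> nAB; apply/eqP=> eAB; case: nAB; rewrite eAB.
  by rewrite !nc ?cards1 ?oG -?orderE ?oy.
apply/subset_leq_card/subsetP=> K; rewrite !inE -orbA.
by case/or3P=> /eqP->;
  rewrite ?sub1G ?normal1 ?subxx ?normal_refl ?cycle_subG ?Gy.
Qed.

End OneClass.

Theorem theorem2p3 (gT : finGroupType) (G : {group gT}) (hG : gamma G = 1) :
  classC G <-> G \isog [set: 'S_3]%G.
Proof.
have [c cE] : exists c, nonnormal_classes G = [set c].
  by apply/cards1P; rewrite -/(gamma G) hG.
have /imsetP[H] : c \in nonnormal_classes G by rewrite cE set11.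
rewrite !inE => /andP[sHG nnH] cH.
have oneH (K : {group gT}) : K \subset G -> ~~ (K <| G)%g ->
  K \in orbit 'JG%act G H.
  move=> sKG nnK;
    suff <- : orbit 'JG%act G K = orbit 'JG%act G H by apply: orbit_refl.
  rewrite -cH; apply/set1P; rewrite -cE; apply/imsetP; exists K => //.
  by rewrite !inE sKG.
split; first exact: classC_isog_S3 oneH.
by move=> /card_isog; rewrite cardsT card_Sn => /(card6_classC sHG nnH oneH).
Qed.
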